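(* Let $(X,\rho)$ be a Hadamard space and let $A:X\rightrightarrows X^{*}$ be a maximally monotone vector field with $\operatorname{dom}(A)=X$. Define $F_A:X\times X\to\mathbb{R}$ by $$F_A(x,y):=\sup_{\xi\in A(x)}\langle\xi,\overrightarrow{xy}\rangle,\qquad x,y\in X.$$ Then $J_{F_A}=R_A$, where $J_{F_A}$ is the resolvent of the bifunction $F_A$ (with $K=X$) and $R_A$ is the resolvent of $A$.
   Context: A Hadamard space is a complete CAT(0) space. For $u,v,x,y\in X$ write $\overrightarrow{uv}:=(u,v)$ and $\langle\overrightarrow{uv},\overrightarrow{xy}\rangle := \tfrac12[\rho^2(u,y)+\rho^2(v,x)-\rho^2(u,x)-\rho^2(v,y)]$ (quasilinearization). Dual space: for $t\in\mathbb{R}$ and $u,v\in X$ let $\Theta(t;\overrightarrow{uv}):X\to\mathbb{R}$, $\Theta(t;\overrightarrow{uv})(x):=t\langle\overrightarrow{uv},\overrightarrow{ux}\rangle$. With $L(h):=\sup\{|h(x)-h(y)|/\rho(x,y): x\neq y\}$ the Lipschitz constant, $\tilde D((s,\overrightarrow{uv}),(t,\overrightarrow{xy})):=L(\Theta(s;\overrightarrow{uv})-\Theta(t;\overrightarrow{xy}))$ is a pseudometric on $\mathbb{R}\times X^2$, and $X^{*}$ is the quotient of $\mathbb{R}\times X^2$ by the relation $\tilde D=0$, the class of $(s,\overrightarrow{uv})$ being written $s\overrightarrow{uv}$ (and $\overrightarrow{uv}$ when $s=1$). The pairing $\langle s\overrightarrow{uv},\overrightarrow{xy}\rangle:=s\langle\overrightarrow{uv},\overrightarrow{xy}\rangle$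 is well defined on $X^{*}$. The tangent space at $p\in X$ is $T_pX:=\{s\overrightarrow{py}: s\ge 0,\ y\in X\}\subset X^{*}$. A set-valued map $A:X\rightrightarrows X^{*}$ is a vector field if $A(x)\subset T_xX$ for every $x\in X$; $\operatorname{dom}(A):=\{x: A(x)\ne\varnothing\}$ and $\operatorname{grp}(A):=\{(x,x^* ): x^*\in A(x)\}$. It is monotone if $\langle x^{*},\overrightarrow{xy}\rangle\le-\langle y^{*},\overrightarrow{yx}\rangle$ for all $(x,x^{*}),(y,y^{*})\in\operatorname{grp}(A)$, and maximally monotone if it is monotone and $\operatorname{grp}(A)$ is not properly contained in the graph of another monotone vector field. (Monotonicity and $\operatorname{dom}(A)=X$ make $F_A$ finite.) Resolvents: $R_A(x):=\{z\in X:\overrightarrow{zx}\in A(z)\}$; for a bifunction $F:X\times X\to\mathbb{R}$, $J_F(x):=\{z\in X: F(z,y)-\langle\overrightarrow{zx},\overrightarrow{zy}\rangle\ge 0\ \forall y\in X\}$. *)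

(* Defs.v *)
From HB Require Import structures.
From mathcomp Require Import all_boot all_order all_algebra generic_quotient.
From mathcomp Require Import all_classical all_reals.
From mathcomp Require Import ereal topology.
From mathcomp Require Import ring lra.

Set Implicit Arguments.
Unset Strict Implicit.
Unset Printing Implicit Defensive.

Import Order.TTheory GRing.Theory Num.Theory.

Local Open Scope classical_set_scope.
Local Open Scope ring_scope.
Local Open Scope quotient_scope.

Section HadamardSpaces.
Context {R : realType}.

(* The library's norm on row vectors is the sup norm, so the distance of the
   Euclidean plane is written out. *)
Definition eucl_dist (a b : 'rV[R]_2) : R :=
  Num.sqrt (\sum_(i < 2) (a ord0 i - b ord0 i) ^+ 2).

Context (X : metricType R).

(* Geodesics from x to y, parametrized proportionally to arc length by [0, 1];
   only the values of g on [0, 1] matter. *)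
Definition geodesic (g : R -> X) (x y : X) : Prop :=
  [/\ g 0 = x, g 1 = y &
      {in `[0, 1] &, forall s t, mdist (g s) (g t) = `|s - t| * mdist x y}].

Definition geodesic_space : Prop :=
  forall x y : X, exists g : R -> X, geodesic g x y.

Definition comparison_triangle (x y z : X) (a b c : 'rV[R]_2) : Prop :=
  [/\ eucl_dist a b = mdist x y, eucl_dist b c = mdist y z &
      eucl_dist c a = mdist z x].

(* Two points on different sides of a geodesic triangle: x is the vertex common
   to the two sides.  As x, y, z are arbitrary and geodesics can be reversed,
   this covers every pair of sides; two points of the same side are always at
   the same distance as their comparison points. *)
Definition CAT0_inequality : Prop :=
  forall (x y z : X) (g h : R -> X) (a b c : 'rV[R]_2),
    geodesic g x y -> geodesic h x z -> comparison_triangle x y z a b c ->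
    {in `[0, 1] &, forall s t,
      mdist (g s) (h t) <=
        eucl_dist ((1 - s) *: a + s *: b) ((1 - t) *: a + t *: c)}.

Definition CAT0 : Prop := geodesic_space /\ CAT0_inequality.

(* completeType would additionally impose a distinguished point. *)
Definition complete_space : Prop :=
  forall F : set_system X, ProperFilter F -> cauchy F -> exists x : X, F --> x.

Definition hadamard : Prop := complete_space /\ CAT0.

End HadamardSpaces.

Section DualSpace.
Context {R : realType} {X : metricType R}.

Definition quasilin (u v x y : X) : R :=
  (mdist u y ^+ 2 + mdist v x ^+ 2 - mdist u x ^+ 2 - mdist v y ^+ 2) / 2.

Definition Theta (t : R) (u v : X) : X -> R := fun x => t * quasilin u v u x.

(* Suprema of ratios are taken in [0, +oo]: the point 0 is added so that the
   Lipschitz constant is 0 (and not -oo) when X has a single point. *)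
Definition lip_const (h : X -> R) : \bar R :=
  ereal_sup (0%:E |` [set (`|h p.1 - h p.2| / mdist p.1 p.2)%:E
                      | p in [set p : X * X | p.1 <> p.2]]).

(* (s, (u, v)) stands for the pair (s, uv), uv being the vector from u to v. *)
Definition Dtilde (a b : R * (X * X)) : \bar R :=
  lip_const (fun x => Theta a.1 a.2.1 a.2.2 x - Theta b.1 b.2.1 b.2.2 x).

Definition dual_rel (a b : R * (X * X)) : bool := `[< Dtilde a b = 0%:E >].

Lemma lip_const_eq0 (h : X -> R) :
  lip_const h = 0%:E <-> forall x y, h x = h y.
Proof.
split=> [h0 x y|hC].
  have [->//|/eqP xy] := eqVneq x y.
  have : ((`|h x - h y| / mdist x y)%:E <= lip_const h)%E.
    by apply: ereal_sup_ubound; right; exists (x, y).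
  have dxy : 0 < mdist x y by rewrite mdist_gt0; exact/eqP.
  rewrite h0 lee_fin ler_pdivrMr// mul0r normr_le0 subr_eq0.
  by move/eqP.
apply/eqP; rewrite eq_le; apply/andP; split.
  apply: ge_ereal_sup => _ [->//|[p _ <-]].
  by rewrite (hC p.1 p.2) subrr normr0 mul0r.
by apply: ereal_sup_ubound; left.
Qed.

Lemma dual_relP (a b : R * (X * X)) :
  reflect (forall x y, a.1 * quasilin a.2.1 a.2.2 x y =
                       b.1 * quasilin b.2.1 b.2.2 x y) (dual_rel a b).
Proof.
have TE t u v x y : t * quasilin u v x y = Theta t u v y - Theta t u v x.
  by rewrite /Theta /quasilin; field.
apply: (iffP (asboolP _)) => [/lip_const_eq0 ab x y|ab].
  by rewrite !TE; have := ab x y; lra.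
by apply/lip_const_eq0 => x y; have := ab x y; rewrite !TE; lra.
Qed.

Lemma dual_rel_refl : reflexive dual_rel.
Proof. by move=> a; apply/dual_relP. Qed.

Lemma dual_rel_sym : symmetric dual_rel.
Proof.
by move=> a b; apply/dual_relP/dual_relP => ab x y; rewrite ab.
Qed.

Lemma dual_rel_trans : transitive dual_rel.
Proof.
move=> b a c /dual_relP ab /dual_relP bc; apply/dual_relP => x y.
by rewrite ab bc.
Qed.

Canonical dual_equiv := EquivRel dual_rel dual_rel_refl dual_rel_sym dual_rel_trans.

End DualSpace.

Definition dual {R : realType} (X : metricType R) : Type :=
  {eq_quot @dual_equiv R X}.

Section VectorFields.
Context {R : realType} {X : metricType R}.

Definition dual_class (s : R) (u v : X) : dual X :=
  \pi_({eq_quot dual_equiv}) (s, (u, v)).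

Definition pairing (xi : dual X) (x y : X) : R :=
  let a := repr (xi : {eq_quot dual_equiv}) in
  a.1 * quasilin a.2.1 a.2.2 x y.

Lemma pairing_class (s : R) (u v x y : X) :
  pairing (dual_class s u v) x y = s * quasilin u v x y.
Proof.
rewrite /pairing /dual_class; case: piP => a /eqmodP/dual_relP E.
by rewrite -E.
Qed.

Definition tangent (p : X) : set (dual X) :=
  [set xi | exists s y, 0 <= s /\ xi = dual_class s p y].

Definition vector_field (A : X -> set (dual X)) : Prop :=
  forall x, A x `<=` tangent x.

Definition dom (A : X -> set (dual X)) : set X := [set x | A x !=set0].

Definition grp (A : X -> set (dual X)) : set (X * dual X) :=
  [set p | A p.1 p.2].

Definition monotone (A : X -> set (dual X)) : Prop :=
  forall x xi y eta, grp A (x, xi) -> grp A (y, eta) ->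
    pairing xi x y <= - pairing eta y x.

Definition maximally_monotone (A : X -> set (dual X)) : Prop :=
  monotone A /\
  forall B, vector_field B -> monotone B -> ~ (grp A `<` grp B).

Definition resolvent (A : X -> set (dual X)) (x : X) : set X :=
  [set z | A z (dual_class 1 z x)].

Definition bifun_resolvent (F : X -> X -> R) (x : X) : set X :=
  [set z | forall y, F z y - quasilin z x z y >= 0].

(* The supremum is taken in R; it is finite when A is monotone with full domain
   (see F_of_has_sup). *)
Definition F_of (A : X -> set (dual X)) (x y : X) : R :=
  sup [set pairing xi x y | xi in A x].

Lemma F_of_has_sup (A : X -> set (dual X)) (x y : X) :
  monotone A -> dom A = setT -> has_sup [set pairing xi x y | xi in A x].
Proof.
move=> mA dA; have dom_x z : A z !=set0 by have : dom A z by rewrite dA.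
split; first by have [xi Axi] := dom_x x; exists (pairing xi x y), xi.
have [eta Aeta] := dom_x y; exists (- pairing eta y x) => _ [xi Axi <-].
exact: mA.
Qed.

End VectorFields.

(* Main.v *)
Require Import Defs.
From mathcomp Require Import all_boot all_order all_algebra.
From mathcomp Require Import all_classical all_reals topology.

(* If [z] lies in the resolvent of [F_A], then monotonicity turns the inequality
   [F_A(z, y) >= <zx, zy>] into [<eta, yz> <= - <zx, zy>] for all [eta] in
   [A(y)]: the pair [(z, zx)] is monotonically related to the graph of [A], so
   it belongs to it by maximality.  The converse inclusion holds because [F_A]
   is a supremum. *)

Import Order.TTheory GRing.Theory Num.Theory.

Local Open Scope classical_set_scope.
Local Open Scope ring_scope.

Lemma quasilin_diag {R : realType} {X : metricType R} (u v x : X) :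
  quasilin u v x x = 0.
Proof. by rewrite /quasilin addrAC addrK subrr mul0r. Qed.

Lemma F_of_le_pairing {R : realType} {X : metricType R}
    {A : X -> set (dual X)} (x : X) {y : X} {eta : dual X} :
  monotone A -> dom A = setT -> A y eta -> F_of A x y <= - pairing eta y x.
Proof.
(* Full domain makes the set under the real supremum nonempty. *)
move=> mA dA Aeta; apply: ge_sup; first exact: (F_of_has_sup x y mA dA).1.
by move=> _ [xi Axi <-]; exact: mA.
Qed.

(** Adjoining [(z, zeta)] to the graph of [A] leaves a monotone vector field, so by maximality the
    pair was already there. *)
Lemma maximally_monotone_mem {R : realType} {X : metricType R}
    (A : X -> set (dual X)) (z : X) (zeta : dual X) :
  vector_field A -> maximally_monotone A -> tangent z zeta ->
  (forall y eta, A y eta -> pairing zeta z y <= - pairing eta y z) ->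
  A z zeta.
Proof.
move=> vA [mA maxA] Tz related; apply: contrapT => nAz.
pose B y : set (dual X) := [set eta | A y eta \/ y = z /\ eta = zeta].
apply: (maxA B).
- by move=> y eta [/vA//|[-> ->]].
- move=> x xi y eta; rewrite /grp /= => -[Axi|[-> ->]] [Aeta|[-> ->]].
  + exact: mA.
  (* The monotonicity inequality is symmetric in the two pairs. *)
  + by rewrite lerNr; exact: related.
  + exact: related.
  + by rewrite /pairing quasilin_diag mulr0 oppr0.
- split=> [[y eta] Aeta|BA]; first by left.
  by apply/nAz/(BA (z, zeta)); right.
Qed.

Theorem proposition6p4 (R : realType) (X : metricType R)
  (A : X -> set (dual X)) :
  hadamard X -> vector_field A -> maximally_monotone A -> dom A = setT ->
  bifun_resolvent (F_of A) = resolvent A.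
Proof.
move=> _ vA maxA dA; have mA := maxA.1.
apply/funext => x; apply/seteqP; split=> z /= zx.
- apply: maximally_monotone_mem => //; first by exists 1, x.
  move=> y eta Aeta; rewrite pairing_class mul1r.
  apply: le_trans (F_of_le_pairing z mA dA Aeta).
  by rewrite -subr_ge0; exact: zx.
(* The factor 1 exhibits [quasilin z x z y] as a pairing with an element of [A z], hence a term of
   the supremum. *)
- move=> y; rewrite subr_ge0 -[leLHS]mul1r -pairing_class.
  by apply: sup_upper_bound; [exact: F_of_has_sup|exists (dual_class 1 z x)].
Qed.
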